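(* Let $(D,\mu,u)$ be an algebra and $T$ a twistor for $D$. Equip $\mathrm{Ker}(\mu)\subseteq D\otimes D$ with the $D^T$-bimodule structure given by $d\rightarrow x=(\mu_{12}\circ T_{13}\circ T_{12})(d\otimes x)$ and $x\leftarrow d=(\mu_{23}\circ T_{13}\circ T_{23})(x\otimes d)$ for $d\in D$, $x\in\mathrm{Ker}(\mu)$, and let $\delta:D\to\mathrm{Ker}(\mu)$, $\delta(d)=d\otimes 1-1\otimes d$. If $T$ is bijective, then $(\mathrm{Ker}(\mu),\delta)$ is a first order differential calculus over the algebra $D^T$.
   Context: $k$ is a field, $\otimes=\otimes_k$, algebras are associative unital $k$-algebras. $T_{ij}$ denotes $T$ acting on the $i$-th and $j$-th factors of $D\otimes D\otimes D$; $\mu_{12}=\mu\otimes\mathrm{id}_D$, $\mu_{23}=\mathrm{id}_D\otimes\mu$. A twistor for $D$ is a linear map $T:D\otimes D\to D\otimes D$ with $T(1\otimes d)=1\otimes d$, $T(d\otimes 1)=d\otimes 1$ for all $d\in D$ and, on $D\otimes D\otimes D$, $\mu_{23}\circ T_{13}\circ T_{12}=T\circ\mu_{23}$, $\mu_{12}\circ T_{13}\circ T_{23}=T\circ\mu_{12}$, $T_{12}\circ T_{23}=T_{23}\circ T_{12}$. Then $D^T$ denotes the associative algebra on the vector space $D$ with multiplication $\mu\circ T$ and the same unit. The displayed formulas do define a $D^T$-bimodule structure on $\mathrm{Ker}(\mu)$. A first order differential calculus over an algebra $E$ is a pair $(M,\delta)$ where $M$ is an $E$-bimodule and $\delta:E\to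 M$ is a derivation such that $M$ is generated by $\{\delta(e):e\in E\}$ as an $E$-bimodule. *)

(* Defs.v *)
From HB Require Import structures.
From mathcomp Require Import all_boot all_algebra.
From mathcomp Require Import boolp.

Set Implicit Arguments.
Unset Strict Implicit.
Unset Printing Implicit Defensive.

Import GRing.Theory.
Local Open Scope ring_scope.
Local Open Scope quotient_scope.

Reserved Notation "x ⊗ y" (at level 40, left associativity).
Reserved Notation "x ⊗ₜ y" (at level 40, left associativity).

(* Formal finite sums of pairs (v, w), i.e. elements of the free commutative
   monoid on V * W (modulo the order of summands), subject to the usual tensor
   relations.  Scalars act on the first component. *)
Inductive tensor_rel (k : fieldType) (V W : lmodType k) :
    seq (V * W) -> seq (V * W) -> Prop :=
  | TRrefl s : tensor_rel s s
  | TRsym s t : tensor_rel s t -> tensor_rel t s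
  | TRtrans s t r : tensor_rel s t -> tensor_rel t r -> tensor_rel s r
  | TRcat s s' t t' :
      tensor_rel s s' -> tensor_rel t t' -> tensor_rel (s ++ t) (s' ++ t')
  | TRcatC s t : tensor_rel (s ++ t) (t ++ s)
  | TR0 w : tensor_rel [:: (0, w)] [::]
  | TRaddl v v' w : tensor_rel [:: (v + v', w)] [:: (v, w); (v', w)]
  | TRaddr v w w' : tensor_rel [:: (v, w + w')] [:: (v, w); (v, w')]
  | TRscale a v w : tensor_rel [:: (a *: v, w)] [:: (v, a *: w)].

Section TensorType.
Variables (k : fieldType) (V W : lmodType k).
Implicit Types s t r : seq (V * W).

Definition tensor_relb s t : bool := `[< tensor_rel s t >].

Lemma tensor_relb_refl : reflexive tensor_relb.
Proof. by move=> s; apply/asboolP; apply: TRrefl. Qed.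

Lemma tensor_relb_sym : symmetric tensor_relb.
Proof. by move=> s t; apply/asboolP/asboolP; apply: TRsym. Qed.

Lemma tensor_relb_trans : transitive tensor_relb.
Proof.
move=> s t r /asboolP h1 /asboolP h2; apply/asboolP.
exact: TRtrans h1 h2.
Qed.

Canonical tensor_equiv :=
  EquivRel tensor_relb tensor_relb_refl tensor_relb_sym tensor_relb_trans.

Definition tensor := {eq_quot tensor_equiv}.

HB.instance Definition _ := Choice.on tensor.
HB.instance Definition _ := Quotient.on tensor.

Lemma tensor_eqP s t : \pi_tensor s = \pi_tensor t <-> tensor_rel s t.
Proof.
split=> [/eqquotP/asboolP//|h]; by apply/eqquotP/asboolP.
Qed.

Lemma tensor_reprP s : tensor_rel (repr (\pi_tensor s)) s.
Proof. by apply/tensor_eqP; rewrite reprK. Qed.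

Definition formal_scale (a : k) s := [seq (a *: p.1, p.2) | p <- s].

Definition tensor_add (x y : tensor) : tensor := \pi_tensor (repr x ++ repr y).
Definition tensor_zero : tensor := \pi_tensor [::].
Definition tensor_scale (a : k) (x : tensor) : tensor :=
  \pi_tensor (formal_scale a (repr x)).
Definition tensor_opp (x : tensor) : tensor := tensor_scale (-1) x.

Lemma formal_scale_rel a s t :
  tensor_rel s t -> tensor_rel (formal_scale a s) (formal_scale a t).
Proof.
elim=> {s t} /=.
- by move=> s; apply: TRrefl.
- by move=> s t _ h; apply: TRsym.
- by move=> s t r _ h1 _ h2; apply: TRtrans h1 h2.
- by move=> s s' t t' _ h1 _ h2; rewrite /formal_scale !map_cat; apply: TRcat.
- by move=> s t; rewrite /formal_scale !map_cat; apply: TRcatC.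
- by move=> w; rewrite scaler0; apply: TR0.
- by move=> v v' w; rewrite scalerDr; apply: TRaddl.
- by move=> v w w'; apply: TRaddr.
- move=> b v w; rewrite scalerA mulrC -scalerA; exact: TRscale.
Qed.

Lemma tensorW (P : tensor -> Prop) :
  (forall s, P (\pi_tensor s)) -> forall x, P x.
Proof. by move=> h x; rewrite -[x]reprK. Qed.

Lemma tensor_addE s t : tensor_add (\pi_tensor s) (\pi_tensor t) = \pi_tensor (s ++ t).
Proof. by apply/tensor_eqP; apply: TRcat; apply: tensor_reprP. Qed.

Lemma tensor_scaleE a s : tensor_scale a (\pi_tensor s) = \pi_tensor (formal_scale a s).
Proof. by apply/tensor_eqP; apply: formal_scale_rel; apply: tensor_reprP. Qed.

Lemma tensor_addA : associative tensor_add.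
Proof.
by elim/tensorW=> s; elim/tensorW=> t; elim/tensorW=> r; rewrite !tensor_addE catA.
Qed.

Lemma tensor_addC : commutative tensor_add.
Proof.
elim/tensorW=> s; elim/tensorW=> t; rewrite !tensor_addE.
by apply/tensor_eqP; apply: TRcatC.
Qed.

Lemma tensor_add0 : left_id tensor_zero tensor_add.
Proof. by elim/tensorW=> s; rewrite tensor_addE. Qed.

Lemma tensor_rel_cons p s t :
  tensor_rel s t -> tensor_rel (p :: s) (p :: t).
Proof. by move=> h; exact: (@TRcat _ _ _ [:: p] [:: p] s t (TRrefl _) h). Qed.

Lemma formal_scaleDl a b s :
  tensor_rel (formal_scale (a + b) s) (formal_scale a s ++ formal_scale b s).
Proof.
elim: s => [|[v w] s ih] /=; first exact: TRrefl.
rewrite scalerDl; apply: TRtrans (TRcat (TRaddl _ _ _) ih) _ => /=.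
set x := (a *: v, w); set y := (b *: v, w).
apply: tensor_rel_cons; rewrite -cat1s -[y :: _ in X in tensor_rel _ X]cat1s !catA.
exact: TRcat (TRcatC _ _) (TRrefl _).
Qed.

Lemma formal_scale0 s : tensor_rel (formal_scale 0 s) [::].
Proof.
elim: s => [|[v w] s ih] /=; first exact: TRrefl.
by rewrite scale0r; exact: (@TRcat _ _ _ [:: _] [::] _ [::] (TR0 _ w) ih).
Qed.

Lemma formal_scale1 s : formal_scale 1 s = s.
Proof.
by rewrite -[RHS]map_id; apply: eq_map => -[v w] /=; rewrite scale1r.
Qed.

Lemma tensor_addN : left_inverse tensor_zero tensor_opp tensor_add.
Proof.
elim/tensorW=> s; rewrite /tensor_opp tensor_scaleE tensor_addE.
apply/tensor_eqP; rewrite -{2}[s]formal_scale1.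
apply: TRtrans (TRsym (formal_scaleDl _ _ _)) _.
by rewrite addNr; apply: formal_scale0.
Qed.

HB.instance Definition _ := GRing.isZmodule.Build tensor
  tensor_addA tensor_addC tensor_add0 tensor_addN.

Lemma tensor_scaleA a b x :
  tensor_scale a (tensor_scale b x) = tensor_scale (a * b) x.
Proof.
elim/tensorW: x => s; rewrite !tensor_scaleE /formal_scale -map_comp.
by congr (\pi_tensor _); apply: eq_map => -[v w] /=; rewrite scalerA.
Qed.

Lemma tensor_scale1 : left_id 1 tensor_scale.
Proof. by elim/tensorW=> s; rewrite tensor_scaleE formal_scale1. Qed.

Lemma tensor_scaleDr : right_distributive tensor_scale +%R.
Proof.
move=> a; elim/tensorW=> s; elim/tensorW=> t.
by rewrite /GRing.add /= tensor_addE !tensor_scaleE tensor_addE /formal_scale map_cat.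
Qed.

Lemma tensor_scaleDl x : {morph tensor_scale^~ x : a b / a + b}.
Proof.
move=> a b; elim/tensorW: x => s.
rewrite /GRing.add /= !tensor_scaleE tensor_addE.
by apply/tensor_eqP; apply: formal_scaleDl.
Qed.

HB.instance Definition _ := GRing.Zmodule_isLmodule.Build k tensor
  tensor_scaleA tensor_scale1 tensor_scaleDr tensor_scaleDl.

Definition pure (v : V) (w : W) : tensor := \pi_tensor [:: (v, w)].

End TensorType.

Notation "V ⊗ W" := (tensor V W) : type_scope.
Notation "v ⊗ₜ w" := (pure v w) : ring_scope.

Section Lift.
Variables (k : fieldType) (V W U : lmodType k).
Implicit Types (v : V) (w : W) (x : V ⊗ W).

Lemma pure_bilinear : bilinear_for *:%R *:%R (@pure k V W).
Proof.
have addE s t : \pi_(tensor V W) s + \pi_(tensor V W) t = \pi_(tensor V W) (s ++ t).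
  exact: tensor_addE.
have scaleE a s : a *: \pi_(tensor V W) s = \pi_(tensor V W) (formal_scale a s).
  exact: tensor_scaleE.
split=> [w a v v'|v a w w'] /=.
  rewrite /pure scaleE addE; apply/tensor_eqP => /=.
  exact: TRaddl.
rewrite /pure scaleE addE; apply/tensor_eqP => /=.
apply: TRtrans (TRaddr _ _ _) _.
exact: (@TRcat _ _ _ [:: _] [:: _] _ _ (TRsym (TRscale _ _ _)) (TRrefl _)).
Qed.

HB.instance Definition _ := bilinear_isBilinear.Build k _ _ _
  _ _ (@pure k V W) pure_bilinear.

Lemma tensor_sum x : x = \sum_(p <- repr x) p.1 ⊗ₜ p.2.
Proof.
rewrite -[LHS]reprK; elim: (repr x) => [|[v w] s ih] /=; first by rewrite big_nil.
rewrite big_cons -ih; exact/esym/tensor_addE.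
Qed.

Lemma tensor_ind (P : V ⊗ W -> Prop) :
  P 0 -> (forall v w x, P x -> P (v ⊗ₜ w + x)) -> forall x, P x.
Proof.
move=> P0 PD x; rewrite [x]tensor_sum.
elim: (repr x) => [|p s ih]; first by rewrite big_nil.
by rewrite big_cons; apply: PD.
Qed.

Lemma sum_bilinear_rel (f : V -> W -> U) s t :
  bilinear_for *:%R *:%R f -> tensor_rel s t ->
  \sum_(p <- s) f p.1 p.2 = \sum_(p <- t) f p.1 p.2.
Proof.
move=> [fl fr]; elim=> {s t} //.
- by move=> s t r _ -> _ ->.
- by move=> s s' t t' _ h1 _ h2; rewrite !big_cat /= h1 h2.
- by move=> s t; rewrite !big_cat /= addrC.
- move=> w; rewrite big_seq1 big_nil /=.
  by have := fl w (-1) 0 0; rewrite /= !scaleN1r !addNr.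
- move=> v v' w; rewrite !big_cons !big_nil !addr0 /=.
  by have := fl w 1 v v'; rewrite /= !scale1r.
- move=> v w w'; rewrite !big_cons !big_nil !addr0 /=.
  by have := fr v 1 w w'; rewrite /= !scale1r.
- move=> a v w; rewrite !big_seq1 /=.
  have f0l : f 0 w = 0 by have := fl w (-1) 0 0; rewrite /= !scaleN1r !addNr.
  have f0r : f v 0 = 0 by have := fr v (-1) 0 0; rewrite /= !scaleN1r !addNr.
  have := fl w a v 0; rewrite /= addr0 f0l addr0 => ->.
  by have := fr v a w 0; rewrite /= addr0 f0r addr0 => ->.
Qed.

(* The linear map induced by a bilinear map; the value does not depend on the
   chosen representative, by [tliftE]. *)
Definition tlift (f : {bilinear V -> W -> U}) x : U :=
  \sum_(p <- repr x) f p.1 p.2.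

Lemma bilinear_forP (f : {bilinear V -> W -> U}) : bilinear_for *:%R *:%R f.
Proof.
split=> [w a v v'|v a w w'] /=; first by rewrite linearPl.
by rewrite linearPr.
Qed.

Lemma tlift_is_linear f : linear (tlift f).
Proof.
move=> a x y; rewrite /tlift.
have -> : a *: (\sum_(p <- repr x) f p.1 p.2)
  = \sum_(p <- formal_scale a (repr x)) f p.1 p.2.
  rewrite big_map scaler_sumr; apply: eq_bigr => p _ /=.
  by rewrite linearZl_LR.
rewrite -big_cat /=; apply: sum_bilinear_rel; first exact: bilinear_forP.
rewrite -{1}[x]reprK -{1}[y]reprK.
have -> s t : a *: \pi_(tensor V W) s + \pi_(tensor V W) t
   = \pi_(tensor V W) (formal_scale a s ++ t).
  by rewrite -tensor_addE -tensor_scaleE.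
exact: tensor_reprP.
Qed.

HB.instance Definition _ (f : {bilinear V -> W -> U}) :=
  GRing.isLinear.Build k _ _ _ (tlift f) (tlift_is_linear f).

Lemma tliftE f v w : tlift f (v ⊗ₜ w) = f v w.
Proof.
rewrite -[RHS](big_seq1 +%R (v, w) (fun p => f p.1 p.2)).
apply: sum_bilinear_rel; [exact: bilinear_forP|exact: tensor_reprP].
Qed.

End Lift.

Section TensorMaps.
Variables (k : fieldType).
Implicit Types U V W : lmodType k.

Lemma tensor_ext V W U (f g : {linear V ⊗ W -> U}) :
  (forall v w, f (v ⊗ₜ w) = g (v ⊗ₜ w)) -> f =1 g.
Proof.
move=> fg; elim/tensor_ind=> [|v w x ih]; first by rewrite !linear0.
by rewrite !linearD fg ih.
Qed.

Definition tmap_pure V W V' W' (f : {linear V -> V'}) (g : {linear W -> W'})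
  (v : V) (w : W) : V' ⊗ W' := f v ⊗ₜ g w.

Lemma tmap_pure_bilinear V W V' W' (f : {linear V -> V'}) (g : {linear W -> W'}) :
  bilinear_for *:%R *:%R (tmap_pure f g).
Proof.
by split=> [w a v v'|v a w w'] /=; rewrite /tmap_pure linearP ?linearPl ?linearPr.
Qed.

HB.instance Definition _ V W V' W' (f : {linear V -> V'}) (g : {linear W -> W'}) :=
  bilinear_isBilinear.Build k _ _ _ _ _ (tmap_pure f g) (tmap_pure_bilinear f g).

Definition tmap V W V' W' (f : {linear V -> V'}) (g : {linear W -> W'}) :
  {linear V ⊗ W -> V' ⊗ W'} := tlift (tmap_pure f g).

Lemma tmapE V W V' W' (f : {linear V -> V'}) (g : {linear W -> W'}) v w :
  tmap f g (v ⊗ₜ w) = f v ⊗ₜ g w.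
Proof. exact: tliftE. Qed.

Definition tswap_pure V W (v : V) (w : W) : W ⊗ V := w ⊗ₜ v.

Lemma tswap_pure_bilinear V W : bilinear_for *:%R *:%R (@tswap_pure V W).
Proof.
by split=> [w a v v'|v a w w'] /=; rewrite /tswap_pure ?linearPl ?linearPr.
Qed.

HB.instance Definition _ V W := bilinear_isBilinear.Build k _ _ _ _ _
  (@tswap_pure V W) (tswap_pure_bilinear V W).

Definition tswap V W : {linear V ⊗ W -> W ⊗ V} := tlift (@tswap_pure V W).

Lemma tswapE V W (v : V) (w : W) : tswap V W (v ⊗ₜ w) = w ⊗ₜ v.
Proof. exact: tliftE. Qed.

Section Assoc.
Variables U V W : lmodType k.

Definition tassoc_in (w : W) (u : U) (v : V) : U ⊗ (V ⊗ W) := u ⊗ₜ (v ⊗ₜ w).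

Lemma tassoc_in_bilinear w : bilinear_for *:%R *:%R (tassoc_in w).
Proof.
by split=> [v a u u'|u a v v'] /=; rewrite /tassoc_in ?linearPl ?linearPr.
Qed.

HB.instance Definition _ w := bilinear_isBilinear.Build k _ _ _ _ _
  (tassoc_in w) (tassoc_in_bilinear w).

Definition tassoc_pure (x : U ⊗ V) (w : W) : U ⊗ (V ⊗ W) :=
  tlift (tassoc_in w) x.

Lemma tassoc_pure_bilinear : bilinear_for *:%R *:%R tassoc_pure.
Proof.
split=> [w a x x'|x a w w'] /=; rewrite /tassoc_pure; first by rewrite linearP.
elim/tensor_ind: x => [|u v x ih]; first by rewrite !linear0 ?scaler0 addr0.
rewrite !linearD /= ih !tliftE.
rewrite ?scalerDr [RHS]addrACA; congr (_ + _).
by rewrite /= /tassoc_in !linearPr.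
Qed.

HB.instance Definition _ := bilinear_isBilinear.Build k _ _ _ _ _
  tassoc_pure tassoc_pure_bilinear.

Definition tassoc : {linear U ⊗ V ⊗ W -> U ⊗ (V ⊗ W)} := tlift tassoc_pure.

Lemma tassocE u v w : tassoc (u ⊗ₜ v ⊗ₜ w) = u ⊗ₜ (v ⊗ₜ w).
Proof. by rewrite [LHS]tliftE [LHS]tliftE. Qed.

Definition tassocV_in (u : U) (v : V) (w : W) : U ⊗ V ⊗ W := u ⊗ₜ v ⊗ₜ w.

Lemma tassocV_in_bilinear u : bilinear_for *:%R *:%R (tassocV_in u).
Proof.
by split=> [w a v v'|v a w w'] /=; rewrite /tassocV_in ?linearPr ?linearPl ?linearPr.
Qed.

HB.instance Definition _ u := bilinear_isBilinear.Build k _ _ _ _ _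
  (tassocV_in u) (tassocV_in_bilinear u).

Definition tassocV_pure (u : U) (x : V ⊗ W) : U ⊗ V ⊗ W :=
  tlift (tassocV_in u) x.

Lemma tassocV_pure_bilinear : bilinear_for *:%R *:%R tassocV_pure.
Proof.
split=> [x a u u'|u a x x'] /=; rewrite /tassocV_pure; last by rewrite linearP.
elim/tensor_ind: x => [|v w x ih]; first by rewrite !linear0 ?scaler0 addr0.
rewrite !linearD /= ih !tliftE.
rewrite ?scalerDr [RHS]addrACA; congr (_ + _).
by rewrite /= /tassocV_in !linearPl.
Qed.

HB.instance Definition _ := bilinear_isBilinear.Build k _ _ _ _ _
  tassocV_pure tassocV_pure_bilinear.

Definition tassocV : {linear U ⊗ (V ⊗ W) -> U ⊗ V ⊗ W} := tlift tassocV_pure.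

Lemma tassocVE u v w : tassocV (u ⊗ₜ (v ⊗ₜ w)) = u ⊗ₜ v ⊗ₜ w.
Proof. by rewrite [LHS]tliftE [LHS]tliftE. Qed.

End Assoc.

(* T_{12}, T_{23} and T_{13} on D ⊗ D ⊗ D = (D ⊗ D) ⊗ D. *)
Definition leg12 (D : lmodType k) (T : {linear D ⊗ D -> D ⊗ D}) :
  {linear D ⊗ D ⊗ D -> D ⊗ D ⊗ D} := tmap T idfun.

Definition leg23 (D : lmodType k) (T : {linear D ⊗ D -> D ⊗ D}) :
    {linear D ⊗ D ⊗ D -> D ⊗ D ⊗ D} :=
  tassocV D D D \o tmap idfun T \o tassoc D D D.

Definition leg13 (D : lmodType k) (T : {linear D ⊗ D -> D ⊗ D}) :
    {linear D ⊗ D ⊗ D -> D ⊗ D ⊗ D} :=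
  leg23 (tswap D D) \o leg12 T \o leg23 (tswap D D).

End TensorMaps.

Arguments tassoc {k U V W}.
Arguments tassocV {k U V W}.

(* Associative unital k-algebras (D, mu, u), with u : k -> D given by the element
   u(1).  The library's [algType] excludes the zero algebra, and here two
   multiplications on the same vector space have to be considered. *)
Record algebra (k : fieldType) := Algebra {
  alg_space :> lmodType k;
  mu : {linear alg_space ⊗ alg_space -> alg_space};
  alg_one : alg_space;
  alg_mulA : forall x y z, mu (mu (x ⊗ₜ y) ⊗ₜ z) = mu (x ⊗ₜ mu (y ⊗ₜ z));
  alg_mul1l : forall x, mu (alg_one ⊗ₜ x) = x;
  alg_mul1r : forall x, mu (x ⊗ₜ alg_one) = x
}.

Arguments mu {k} D : rename.
Arguments alg_one {k} D : rename.

Section LibraryAlgebra.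
Variables (k : fieldType) (A : algType k).

Definition alg_mul (x y : A) : A := x * y.

Lemma alg_mul_bilinear : bilinear_for *:%R *:%R alg_mul.
Proof.
split=> [y a x x'|x a y y'] /=; rewrite /alg_mul.
  by rewrite mulrDl scalerAl.
by rewrite mulrDr scalerAr.
Qed.

HB.instance Definition _ :=
  bilinear_isBilinear.Build k _ _ _ _ _ alg_mul alg_mul_bilinear.

Definition alg_mu : {linear A ⊗ A -> A} := tlift alg_mul.

Lemma alg_muE x y : alg_mu (x ⊗ₜ y) = x * y.
Proof. exact: tliftE. Qed.

Lemma alg_muA x y z : alg_mu (alg_mu (x ⊗ₜ y) ⊗ₜ z) = alg_mu (x ⊗ₜ alg_mu (y ⊗ₜ z)).
Proof. by rewrite !alg_muE mulrA. Qed.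

Lemma alg_mu1l x : alg_mu (1 ⊗ₜ x) = x.
Proof. by rewrite alg_muE mul1r. Qed.

Lemma alg_mu1r x : alg_mu (x ⊗ₜ 1) = x.
Proof. by rewrite alg_muE mulr1. Qed.

Definition algebra_of_algType : algebra k :=
  @Algebra k A alg_mu 1 alg_muA alg_mu1l alg_mu1r.

End LibraryAlgebra.

Section Twistor.
Variables (k : fieldType) (D : algebra k).

Definition mu12 : {linear D ⊗ D ⊗ D -> D ⊗ D} := tmap (mu D) idfun.
Definition mu23 : {linear D ⊗ D ⊗ D -> D ⊗ D} := tmap idfun (mu D) \o tassoc.

Record twistor (T : {linear D ⊗ D -> D ⊗ D}) : Prop := Twistor {
  twistor_1l : forall d, T (alg_one D ⊗ₜ d) = alg_one D ⊗ₜ d;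
  twistor_1r : forall d, T (d ⊗ₜ alg_one D) = d ⊗ₜ alg_one D;
  twistor_mu23 : mu23 \o leg13 T \o leg12 T =1 T \o mu23;
  twistor_mu12 : mu12 \o leg13 T \o leg23 T =1 T \o mu12;
  twistor_comm : leg12 T \o leg23 T =1 leg23 T \o leg12 T
}.

End Twistor.

Arguments twistor {k} D T.
Arguments mu12 {k} D.
Arguments mu23 {k} D.

Section TwistorTheory.
Variables (k : fieldType) (D : algebra k) (T : {linear D ⊗ D -> D ⊗ D}).

(* [J a b F] is the sum of the F a_T b_T over T (a ⊗ b) = \sum a_T ⊗ b_T. *)
Definition J (U : lmodType k) (a b : D) (F : D -> D -> U) : U :=
  \sum_(p <- repr (T (a ⊗ₜ b))) F p.1 p.2.

Definition lin (U V : lmodType k) (f : U -> V) := linear f.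
Definition bilin (U V W : lmodType k) (F : U -> V -> W) :=
  (forall v, lin (F^~ v)) /\ (forall u, lin (F u)).

Implicit Types U V W : lmodType k.

Lemma bilin_for U V W (F : U -> V -> W) : bilin F -> bilinear_for *:%R *:%R F.
Proof. by case=> Fl Fr; split. Qed.

Definition bilin_map U V W (F : U -> V -> W) (_ : bilin F) := F.
HB.instance Definition _ U V W (F : U -> V -> W) (FP : bilin F) :=
  bilinear_isBilinear.Build k _ _ _ _ _ (bilin_map FP) (bilin_for FP).

Lemma lin_linear U V (f : {linear U -> V}) : lin f.
Proof. by move=> a x y; rewrite linearP. Qed.

Lemma lin_id U : lin (fun x : U => x). Proof. by []. Qed.

Lemma lin_comp U V W (f : V -> W) (g : U -> V) :
  lin f -> lin g -> lin (fun x => f (g x)).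
Proof. by move=> lf lg a x y; rewrite lg lf. Qed.

Lemma lin_app U V W (f : {linear V -> W}) (g : U -> V) :
  lin g -> lin (fun x => f (g x)).
Proof. exact/lin_comp/lin_linear. Qed.

Lemma lin_purel U V W (f : U -> V) (c : W) : lin f -> lin (fun x => f x ⊗ₜ c).
Proof. by move=> lf a x y; rewrite lf linearPl. Qed.

Lemma lin_purer U V W (f : U -> V) (c : W) : lin f -> lin (fun x => c ⊗ₜ f x).
Proof. by move=> lf a x y; rewrite lf linearPr. Qed.

Local Notation "x * y" := (mu D (x ⊗ₜ y)) : ring_scope.

Lemma lin_mull U (f : U -> D) c : lin f -> lin (fun x => f x * c).
Proof. by move=> lf; apply/lin_app/lin_purel. Qed.

Lemma lin_mulr U (f : U -> D) c : lin f -> lin (fun x => c * f x).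
Proof. by move=> lf; apply/lin_app/lin_purer. Qed.

Lemma lin_sum U V I (r : seq I) (F : U -> I -> V) :
  (forall i, lin (F^~ i)) -> lin (fun x => \sum_(i <- r) F x i).
Proof.
move=> lF a x y; rewrite scaler_sumr -big_split /=.
by apply: eq_bigr => i _; apply: lF.
Qed.

Lemma lin_JF U V a b (F : U -> D -> D -> V) :
  (forall x y, lin (fun t => F t x y)) -> lin (fun t => J a b (F t)).
Proof. by move=> lF; apply: lin_sum => p; apply: lF. Qed.

Lemma J_tlift U a b (F : D -> D -> U) (FP : bilin F) :
  J a b F = tlift (bilin_map FP) (T (a ⊗ₜ b)).
Proof. by []. Qed.

Lemma lin_J1 U V (h : U -> D) b (F : D -> D -> V) :
  lin h -> bilin F -> lin (fun t => J (h t) b F).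
Proof.
move=> lh FP a x y; rewrite !(J_tlift _ _ FP) lh linearPl.
by rewrite !linearP.
Qed.

Lemma lin_J2 U V (h : U -> D) b (F : D -> D -> V) :
  lin h -> bilin F -> lin (fun t => J b (h t) F).
Proof.
move=> lh FP a x y; rewrite !(J_tlift _ _ FP) lh linearPr.
by rewrite !linearP.
Qed.

Lemma app_J U V (f : {linear U -> V}) a b (F : D -> D -> U) :
  f (J a b F) = J a b (fun x y => f (F x y)).
Proof. exact: linear_sum. Qed.

Lemma eq_J U a b (F G : D -> D -> U) :
  (forall x y, F x y = G x y) -> J a b F = J a b G.
Proof. by move=> FG; apply: eq_bigr. Qed.

Lemma TJ a b : T (a ⊗ₜ b) = J a b (fun x y => x ⊗ₜ y).
Proof. exact: tensor_sum. Qed.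

Lemma exchange_J U a b c d (F : D -> D -> D -> D -> U) :
  J a b (fun x y => J c d (fun z w => F x y z w)) =
  J c d (fun z w => J a b (fun x y => F x y z w)).
Proof. exact: exchange_big. Qed.

Lemma pure_Jl U V a b (F : D -> D -> U) (v : V) :
  J a b F ⊗ₜ v = J a b (fun x y => F x y ⊗ₜ v).
Proof. exact: linear_sumlz. Qed.

Lemma pure_Jr U V a b (F : D -> D -> U) (v : V) :
  v ⊗ₜ J a b F = J a b (fun x y => v ⊗ₜ F x y).
Proof. exact: linear_sumr. Qed.

Lemma leg12E a b c : leg12 T (a ⊗ₜ b ⊗ₜ c) = J a b (fun x y => x ⊗ₜ y ⊗ₜ c).
Proof. by rewrite [LHS]tmapE TJ pure_Jl. Qed.

Lemma leg23E a b c : leg23 T (a ⊗ₜ b ⊗ₜ c) = J b c (fun x y => a ⊗ₜ x ⊗ₜ y).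
Proof.
rewrite /leg23 /= tassocE tmapE TJ pure_Jr app_J.
by apply: eq_J => x y; rewrite tassocVE.
Qed.

Lemma leg23_swapE a b c :
  leg23 (tswap D D) (a ⊗ₜ b ⊗ₜ c) = a ⊗ₜ c ⊗ₜ b.
Proof. by rewrite /leg23 /= tassocE tmapE /= tswapE tassocVE. Qed.

Lemma leg13E a b c : leg13 T (a ⊗ₜ b ⊗ₜ c) = J a c (fun x y => x ⊗ₜ b ⊗ₜ y).
Proof.
rewrite -[LHS]/(leg23 _ (leg12 T (leg23 _ _))) leg23_swapE leg12E app_J.
by apply: eq_J => x y; rewrite leg23_swapE.
Qed.

Lemma mu12E a b c : mu12 D (a ⊗ₜ b ⊗ₜ c) = (a * b) ⊗ₜ c.
Proof. exact: tmapE. Qed.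

Lemma mu23E a b c : mu23 D (a ⊗ₜ b ⊗ₜ c) = a ⊗ₜ (b * c).
Proof. by rewrite /mu23 /= tassocE tmapE. Qed.

Definition trilin U (F : D -> D -> D -> U) :=
  [/\ forall y z, lin (fun x => F x y z), forall x z, lin (fun y => F x y z)
    & forall x y, lin (fun z => F x y z)].

Lemma trilin_lift U (F : D -> D -> D -> U) : trilin F ->
  exists f : {linear D ⊗ D ⊗ D -> U}, forall a b c, f (a ⊗ₜ b ⊗ₜ c) = F a b c.
Proof.
move=> [F1 F2 F3].
have FP c : bilin (fun a b => F a b c) by split=> *; [apply: F1|apply: F2].
pose G (x : D ⊗ D) (c : D) := \sum_(p <- repr x) F p.1 p.2 c.
have GE x c : G x c = tlift (bilin_map (FP c)) x by [].
have GP : bilin G.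
  split=> [c a x y|x]; first by rewrite !GE linearP.
  by apply: lin_sum => p; apply: F3.
exists (tlift (bilin_map GP)) => a b c.
rewrite [LHS]tliftE -[LHS]/(G _ _) GE; exact: tliftE.
Qed.

Hypothesis hT : twistor D T.

Lemma J_mulr U a b c (F : D -> D -> U) : bilin F ->
  J a (b * c) F = J a b (fun x y => J x c (fun x' z => F x' (y * z))).
Proof.
move=> FP; rewrite (J_tlift _ _ FP).
have /esym := twistor_mu23 hT (a ⊗ₜ b ⊗ₜ c).
rewrite -[LHS]/(T (mu23 D _)) -[RHS]/(mu23 D (leg13 T (leg12 T _))) mu23E => ->.
rewrite leg12E !app_J; apply: eq_J => x y.
rewrite leg13E !app_J; apply: eq_J => x' z.
by rewrite mu23E [LHS]tliftE.
Qed.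

Lemma J_mull U a b c (F : D -> D -> U) : bilin F ->
  J (a * b) c F = J b c (fun y z => J a z (fun x z' => F (x * y) z')).
Proof.
move=> FP; rewrite (J_tlift _ _ FP).
have /esym := twistor_mu12 hT (a ⊗ₜ b ⊗ₜ c).
rewrite -[LHS]/(T (mu12 D _)) -[RHS]/(mu12 D (leg13 T (leg23 T _))) mu12E => ->.
rewrite leg23E !app_J; apply: eq_J => x y.
rewrite leg13E !app_J; apply: eq_J => x' z.
by rewrite mu12E [LHS]tliftE.
Qed.

Lemma J_comm U a b c (F : D -> D -> D -> U) : trilin F ->
  J b c (fun y z => J a y (fun x y' => F x y' z)) =
  J a b (fun x y => J y c (fun y' z => F x y' z)).
Proof.
case/trilin_lift=> f fE.
have := congr1 f (twistor_comm hT (a ⊗ₜ b ⊗ₜ c)).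
rewrite -[LHS]/(f (leg12 T (leg23 T _))) -[RHS]/(f (leg23 T (leg12 T _))) leg12E leg23E !app_J => h.
apply: etrans (etrans h _).
  apply: eq_J => y z; rewrite leg12E app_J.
  by apply: eq_J => x y'; rewrite fE.
apply: eq_J => x y; rewrite leg23E app_J.
by apply: eq_J => y' z; rewrite fE.
Qed.

Lemma J_1l U a (F : D -> D -> U) : bilin F -> J (alg_one D) a F = F (alg_one D) a.
Proof. by move=> FP; rewrite (J_tlift _ _ FP) (twistor_1l hT) [LHS]tliftE. Qed.

Lemma J_1r U a (F : D -> D -> U) : bilin F -> J a (alg_one D) F = F a (alg_one D).
Proof. by move=> FP; rewrite (J_tlift _ _ FP) (twistor_1r hT) [LHS]tliftE. Qed.

Local Ltac lin_tac :=
  repeat first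
    [ assumption | apply: lin_id | apply: lin_JF => ? ? | apply: lin_J1 | apply: lin_J2
    | apply: lin_purel | apply: lin_purer | apply: lin_mull | apply: lin_mulr
    | split => * ].

Lemma lin0 U V (f : U -> V) : lin f -> f 0 = 0.
Proof. by move=> /(_ (-1) 0 0); rewrite !scaleN1r !addNr. Qed.

Lemma lin_fun_J U V (f : U -> V) a b (F : D -> D -> U) : lin f ->
  f (J a b F) = J a b (fun x y => f (F x y)).
Proof.
move=> lf; rewrite /J; elim: (repr _) => [|p s ih].
  by rewrite !big_nil lin0.
by rewrite !big_cons -[F _ _]scale1r lf scale1r ih !scale1r.
Qed.

Lemma JJ1 U a b c (F : D -> D -> D) (G : D -> D -> U) : bilin G ->
  J (J a b F) c G = J a b (fun x y => J (F x y) c G).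
Proof.
by move=> GP; rewrite (lin_fun_J (f := fun t => J t c G)) //; lin_tac.
Qed.

Lemma JJ2 U a b c (F : D -> D -> D) (G : D -> D -> U) : bilin G ->
  J c (J a b F) G = J a b (fun x y => J c (F x y) G).
Proof.
by move=> GP; rewrite (lin_fun_J (f := fun t => J c t G)) //; lin_tac.
Qed.

Lemma twisted_mulE a b : mu D (T (a ⊗ₜ b)) = J a b (fun x y => x * y).
Proof. by rewrite TJ app_J. Qed.

Lemma twisted_mulA a b c :
  mu D (T (mu D (T (a ⊗ₜ b)) ⊗ₜ c)) = mu D (T (a ⊗ₜ mu D (T (b ⊗ₜ c)))).
Proof.
rewrite !twisted_mulE JJ1; last by lin_tac.
rewrite JJ2; last by lin_tac.
transitivity (J a b (fun x y => J y c (fun y' z => J x z (fun x' z' =>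
  (x' * y') * z')))).
  by apply: eq_J => x y; rewrite J_mull //; lin_tac.
rewrite -(J_comm a b c (F := fun x y' z => J x z (fun x' z' => (x' * y') * z')));
  last by lin_tac.
apply: eq_J => y z; rewrite J_mulr; last by lin_tac.
by do 2!apply: eq_J => ? ?; rewrite alg_mulA.
Qed.

Definition twisted_lact (d : D) (x : D ⊗ D) : D ⊗ D :=
  mu12 D (leg13 T (leg12 T (tassocV (d ⊗ₜ x)))).

Definition twisted_ract (x : D ⊗ D) (d : D) : D ⊗ D :=
  mu23 D (leg13 T (leg23 T (x ⊗ₜ d))).

Lemma twisted_lact_lin : bilin twisted_lact.
Proof.
by split=> [x|d]; apply/lin_app/lin_app/lin_app/lin_app; lin_tac.
Qed.

Lemma twisted_ract_lin : bilin twisted_ract.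
Proof.
by split=> [d|x]; apply/lin_app/lin_app/lin_app; lin_tac.
Qed.

Lemma twisted_lactE d a b : twisted_lact d (a ⊗ₜ b) =
  J d a (fun x a' => J x b (fun x' b' => (x' * a') ⊗ₜ b')).
Proof.
rewrite /twisted_lact tassocVE leg12E !app_J; apply: eq_J => x a'.
by rewrite leg13E app_J; apply: eq_J => x' b'; rewrite mu12E.
Qed.

Lemma twisted_ractE d a b : twisted_ract (a ⊗ₜ b) d =
  J b d (fun b' z => J a z (fun a' z' => a' ⊗ₜ (b' * z'))).
Proof.
rewrite /twisted_ract leg23E !app_J; apply: eq_J => x a'.
by rewrite leg13E app_J; apply: eq_J => x' b'; rewrite mu23E.
Qed.

Lemma lin_ext U V W (f g : V ⊗ W -> U) : lin f -> lin g ->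
  (forall v w, f (v ⊗ₜ w) = g (v ⊗ₜ w)) -> f =1 g.
Proof.
move=> lf lg fg; elim/tensor_ind=> [|v w x ih]; first by rewrite !lin0.
by rewrite -[v ⊗ₜ w]scale1r lf lg fg ih.
Qed.

Local Ltac lact_tac := first [apply: twisted_lact_lin.1 | apply: twisted_lact_lin.2
  | apply: twisted_ract_lin.1 | apply: twisted_ract_lin.2].

Lemma twisted_lact1 x : twisted_lact (alg_one D) x = x.
Proof.
move: x; apply: (lin_ext (f := twisted_lact (alg_one D)) (g := id)); first by lact_tac.
  exact: lin_id.
move=> a b; rewrite twisted_lactE J_1l; last by lin_tac.
by rewrite J_1l ?alg_mul1l //; lin_tac.
Qed.

Lemma twisted_ract1 x : twisted_ract x (alg_one D) = x.
Proof.
move: x; apply: (lin_ext (f := twisted_ract^~ (alg_one D)) (g := id)); first by lact_tac.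
  exact: lin_id.
move=> a b; rewrite twisted_ractE J_1r; last by lin_tac.
by rewrite J_1r ?alg_mul1r //; lin_tac.
Qed.

Lemma twisted_lactA d e x :
  twisted_lact (mu D (T (d ⊗ₜ e))) x = twisted_lact d (twisted_lact e x).
Proof.
move: x; apply: (lin_ext (f := twisted_lact (mu D (T (d ⊗ₜ e))))
  (g := fun x => twisted_lact d (twisted_lact e x))); [by lact_tac|by apply: (lin_comp (f := twisted_lact d)); lact_tac|move=> a b].
rewrite twisted_mulE twisted_lactE JJ1; last by lin_tac.
pose G (x'' y'' a2 b2 : D) := ((x'' * y'') * a2) ⊗ₜ b2.
transitivity (J d e (fun x y => J y a (fun y1 a1 => J y1 b (fun y2 b1 =>
  J x a1 (fun x' a2 => J x' b1 (fun x'' b2 => G x'' y2 a2 b2)))))).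
  apply: eq_J => x y; rewrite J_mull; last by lin_tac.
  apply: eq_J => y' a1; rewrite exchange_J; apply: eq_J => x' a2.
  by rewrite J_mull //; lin_tac.
rewrite -(J_comm d e a (F := fun x y1 a1 => J y1 b (fun y2 b1 =>
  J x a1 (fun x' a2 => J x' b1 (fun x'' b2 => G x'' y2 a2 b2))))); last first.
  by rewrite /G; lin_tac.
rewrite twisted_lactE (lin_fun_J (f := twisted_lact d)); last by lact_tac.
apply: eq_J => y a1.
rewrite (lin_fun_J (f := twisted_lact d)); last by lact_tac.
rewrite -(J_comm d y b (F := fun x y2 b1 =>
  J x a1 (fun x' a2 => J x' b1 (fun x'' b2 => G x'' y2 a2 b2)))); last first.
  by rewrite /G; lin_tac.
apply: eq_J => y' b1; rewrite twisted_lactE J_mulr; last by lin_tac.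
by do 3!apply: eq_J => ? ?; rewrite /G alg_mulA.
Qed.

Lemma twisted_ractA d e x :
  twisted_ract x (mu D (T (d ⊗ₜ e))) = twisted_ract (twisted_ract x d) e.
Proof.
move: x; apply: (lin_ext (f := twisted_ract^~ (mu D (T (d ⊗ₜ e))))
  (g := fun x => twisted_ract (twisted_ract x d) e)); [by lact_tac|by apply: (lin_comp (f := twisted_ract^~ e)); lact_tac|move=> a b].
rewrite twisted_mulE twisted_ractE JJ2; last by lin_tac.
pose G (a2 b2 z2 w2 : D) := a2 ⊗ₜ (b2 * (z2 * w2)).
transitivity (J d e (fun z w => J b z (fun b1 z1 => J a z1 (fun a1 z2 =>
  J b1 w (fun b2 w1 => J a1 w1 (fun a2 w2 => G a2 b2 z2 w2)))))).
  apply: eq_J => x y; rewrite J_mulr; last by lin_tac.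
  apply: eq_J => y' a1; rewrite exchange_J; apply: eq_J => x' a2.
  by rewrite J_mulr //; lin_tac.
rewrite (J_comm b d e (F := fun b1 z1 w => J a z1 (fun a1 z2 =>
  J b1 w (fun b2 w1 => J a1 w1 (fun a2 w2 => G a2 b2 z2 w2))))); last first.
  by rewrite /G; lin_tac.
rewrite twisted_ractE (lin_fun_J (f := twisted_ract^~ e)); last by lact_tac.
apply: eq_J => b1 z.
rewrite (lin_fun_J (f := twisted_ract^~ e)); last by lact_tac.
rewrite (J_comm a z e (F := fun a1 z2 w =>
  J b1 w (fun b2 w1 => J a1 w1 (fun a2 w2 => G a2 b2 z2 w2)))); last first.
  by rewrite /G; lin_tac.
apply: eq_J => a1 z1; rewrite twisted_ractE J_mull; last by lin_tac.
by do 3!apply: eq_J => ? ?; rewrite /G alg_mulA.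
Qed.

Lemma twisted_lractA d e x :
  twisted_ract (twisted_lact d x) e = twisted_lact d (twisted_ract x e).
Proof.
move: x; apply: (lin_ext (f := fun x => twisted_ract (twisted_lact d x) e)
  (g := fun x => twisted_lact d (twisted_ract x e))); try by [apply: (lin_comp (f := twisted_ract^~ e)); lact_tac
  |apply: (lin_comp (f := twisted_lact d)); lact_tac].
move=> a b.
pose G (x'' a2 b2 z2 : D) := (x'' * a2) ⊗ₜ (b2 * z2).
pose H a1 x' b2 z := J a1 z (fun a2 z1 => J x' z1 (fun x'' z2 => G x'' a2 b2 z2)).
have Hlin a1 : trilin (H a1) by rewrite /H /G; lin_tac.
transitivity (J d a (fun x a1 => J b e (fun b1 z => J x b1 (fun x' b2 =>
    H a1 x' b2 z)))).
  rewrite twisted_lactE (lin_fun_J (f := twisted_ract^~ e)); last by lact_tac.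
  apply: eq_J => x a1; rewrite (lin_fun_J (f := twisted_ract^~ e)); last by lact_tac.
  rewrite (J_comm x b e) //; apply: eq_J => x' b1.
  rewrite twisted_ractE; apply: eq_J => b2 z.
  by rewrite J_mull //; lin_tac.
rewrite exchange_J twisted_ractE (lin_fun_J (f := twisted_lact d)); last by lact_tac.
apply: eq_J => b1 z; rewrite (lin_fun_J (f := twisted_lact d)); last by lact_tac.
transitivity (J d a (fun x a1 => J a1 z (fun a2 z1 => J x b1 (fun x' b2 =>
    J x' z1 (fun x'' z2 => G x'' a2 b2 z2))))).
  by apply: eq_J => x a1; rewrite exchange_J.
rewrite -(J_comm d a z (F := fun x a2 z1 => J x b1 (fun x' b2 =>
    J x' z1 (fun x'' z2 => G x'' a2 b2 z2)))); last by rewrite /G; lin_tac.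
apply: eq_J => a1 z1; rewrite twisted_lactE; apply: eq_J => x a2.
by rewrite J_mulr //; lin_tac.
Qed.

Lemma mu_twisted_lact d x : mu D (twisted_lact d x) = mu D (T (d ⊗ₜ mu D x)).
Proof.
move: x; apply: (lin_ext (f := fun x => mu D (twisted_lact d x))
  (g := fun x => mu D (T (d ⊗ₜ mu D x)))).
- by apply: lin_app; lact_tac.
- by do 2!apply: lin_app; apply: lin_purer; apply: lin_linear.
move=> a b; rewrite twisted_mulE J_mulr; last by lin_tac.
rewrite twisted_lactE !app_J; apply: eq_J => x a'; rewrite app_J.
by apply: eq_J => x' b'; rewrite alg_mulA.
Qed.

Lemma mu_twisted_ract d x : mu D (twisted_ract x d) = mu D (T (mu D x ⊗ₜ d)).
Proof.
move: x; apply: (lin_ext (f := fun x => mu D (twisted_ract x d))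
  (g := fun x => mu D (T (mu D x ⊗ₜ d)))).
- by apply: lin_app; lact_tac.
- by do 2!apply: lin_app; apply: lin_purel; apply: lin_linear.
move=> a b; rewrite twisted_mulE J_mull; last by lin_tac.
rewrite twisted_ractE !app_J; apply: eq_J => x a'; rewrite app_J.
by apply: eq_J => x' b'; rewrite alg_mulA.
Qed.

Lemma twisted_mul1l x : mu D (T (alg_one D ⊗ₜ x)) = x.
Proof. by rewrite (twistor_1l hT) alg_mul1l. Qed.

Lemma twisted_mul1r x : mu D (T (x ⊗ₜ alg_one D)) = x.
Proof. by rewrite (twistor_1r hT) alg_mul1r. Qed.

End TwistorTheory.

(* The algebra D^T: same space and unit, multiplication mu \o T. *)
Definition twisted_algebra (k : fieldType) (D : algebra k)
    (T : {linear D ⊗ D -> D ⊗ D}) (hT : twistor D T) : algebra k :=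
  @Algebra k (alg_space D) (mu D \o T) (alg_one D)
    (twisted_mulA hT) (twisted_mul1l hT) (twisted_mul1r hT).

Record bimodule (k : fieldType) (E : algebra k) := Bimodule {
  bimod_space :> lmodType k;
  lact : E -> bimod_space -> bimod_space;
  ract : bimod_space -> E -> bimod_space;
  lact_bilinear : bilinear_for *:%R *:%R lact;
  ract_bilinear : bilinear_for *:%R *:%R ract;
  lact1 : forall m, lact (alg_one E) m = m;
  ract1 : forall m, ract m (alg_one E) = m;
  lactA : forall a b m, lact (mu E (a ⊗ₜ b)) m = lact a (lact b m);
  ractA : forall a b m, ract m (mu E (a ⊗ₜ b)) = ract (ract m a) b;
  lractA : forall a b m, ract (lact a m) b = lact a (ract m b)
}.

Section Calculus.
Variables (k : fieldType) (E : algebra k) (M : bimodule E).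

Definition derivation (delta : E -> M) : Prop :=
  linear delta /\
  forall a b, delta (mu E (a ⊗ₜ b)) = lact a (delta b) + ract (delta a) b.

Record subbimodule (N : M -> Prop) : Prop := Subbimodule {
  subbimod0 : N 0;
  subbimodD : forall m n, N m -> N n -> N (m + n);
  subbimodZ : forall (a : k) m, N m -> N (a *: m);
  subbimod_lact : forall a m, N m -> N (lact a m);
  subbimod_ract : forall a m, N m -> N (ract m a)
}.

Definition bimodule_generated_by (S : M -> Prop) : Prop :=
  forall N : M -> Prop, subbimodule N -> (forall m, S m -> N m) ->
  forall m, N m.

Definition first_order_differential_calculus (delta : E -> M) : Prop :=
  derivation delta /\ bimodule_generated_by (fun m => exists e, m = delta e).

End Calculus.

Arguments derivation {k E} M delta.
Arguments bimodule_generated_by {k E} M S.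
Arguments first_order_differential_calculus {k E} M delta.

Section KerMu.
Variables (k : fieldType) (D : algebra k).

Definition in_kermu : {pred D ⊗ D} := fun x => mu D x == 0.

Lemma in_kermuE x : (x \in in_kermu) = (mu D x == 0).
Proof. by []. Qed.

Lemma in_kermu_submod : submod_closed in_kermu.
Proof.
split=> [|a x y]; rewrite !in_kermuE ?linear0 // => /eqP x0 /eqP y0.
by rewrite linearP x0 y0 scaler0 addr0.
Qed.

HB.instance Definition _ :=
  GRing.isSubmodClosed.Build k (D ⊗ D) in_kermu in_kermu_submod.

Record kermu := KerMu { kermu_val :> D ⊗ D; kermuP : kermu_val \in in_kermu }.

HB.instance Definition _ := [isSub for kermu_val].
HB.instance Definition _ := [Choice of kermu by <:].
HB.instance Definition _ := [SubChoice_isSubLmodule of kermu by <:].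

Lemma delta_in_kermu (d : D) : d ⊗ₜ alg_one D - alg_one D ⊗ₜ d \in in_kermu.
Proof. by rewrite in_kermuE linearB /= alg_mul1l alg_mul1r subrr. Qed.

Definition kermu_delta (d : D) : kermu :=
  @KerMu (d ⊗ₜ alg_one D - alg_one D ⊗ₜ d) (delta_in_kermu d).

Variables (T : {linear D ⊗ D -> D ⊗ D}) (hT : twistor D T).

Lemma lact_in_kermu (d : D) (x : kermu) :
  mu12 D (leg13 T (leg12 T (tassocV (d ⊗ₜ kermu_val x)))) \in in_kermu.
Proof.
rewrite in_kermuE; apply/eqP; apply: etrans (mu_twisted_lact hT d _) _.
by have /eqP -> := kermuP x; rewrite linear0r !linear0.
Qed.

Lemma ract_in_kermu (x : kermu) (d : D) :
  mu23 D (leg13 T (leg23 T (kermu_val x ⊗ₜ d))) \in in_kermu.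
Proof.
rewrite in_kermuE; apply/eqP; apply: etrans (mu_twisted_ract hT d _) _.
by have /eqP -> := kermuP x; rewrite linear0l !linear0.
Qed.

Definition kermu_lact (d : D) (x : kermu) : kermu :=
  @KerMu (mu12 D (leg13 T (leg12 T (tassocV (d ⊗ₜ kermu_val x)))))
    (lact_in_kermu d x).

Definition kermu_ract (x : kermu) (d : D) : kermu :=
  @KerMu (mu23 D (leg13 T (leg23 T (kermu_val x ⊗ₜ d))))
    (ract_in_kermu x d).

Lemma kermu_lact_bilinear : bilinear_for *:%R *:%R kermu_lact.
Proof.
have [Ll Lr] := twisted_lact_lin T.
split=> [x a d d'|d a x x']; apply: val_inj; rewrite linearP.
  exact: Ll.
by apply: etrans (Lr _ _ _ _).
Qed.

Lemma kermu_ract_bilinear : bilinear_for *:%R *:%R kermu_ract.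
Proof.
have [Ll Lr] := twisted_ract_lin T.
split=> [d a x x'|x a d d']; apply: val_inj; rewrite linearP.
  by apply: etrans (Ll _ _ _ _).
exact: Lr.
Qed.

Lemma kermu_lact1 x : kermu_lact (alg_one D) x = x.
Proof. by apply: val_inj; apply: twisted_lact1. Qed.

Lemma kermu_ract1 x : kermu_ract x (alg_one D) = x.
Proof. by apply: val_inj; apply: twisted_ract1. Qed.

Lemma kermu_lactA d e x :
  kermu_lact (mu D (T (d ⊗ₜ e))) x = kermu_lact d (kermu_lact e x).
Proof. by apply: val_inj; apply: twisted_lactA. Qed.

Lemma kermu_ractA d e x :
  kermu_ract x (mu D (T (d ⊗ₜ e))) = kermu_ract (kermu_ract x d) e.
Proof. by apply: val_inj; apply: twisted_ractA. Qed.

Lemma kermu_lractA d e x :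
  kermu_ract (kermu_lact d x) e = kermu_lact d (kermu_ract x e).
Proof. by apply: val_inj; apply: twisted_lractA. Qed.

Definition kermu_bimodule : bimodule (twisted_algebra hT) :=
  @Bimodule k (twisted_algebra hT) kermu kermu_lact kermu_ract
    kermu_lact_bilinear kermu_ract_bilinear kermu_lact1 kermu_ract1
    kermu_lactA kermu_ractA kermu_lractA.

End KerMu.

Arguments kermu_delta {k} D d.

(* Main.v *)
(* For all a, b the left action gives a → δ(b) = μ(T(a ⊗ b)) ⊗ 1 - T(a ⊗ b).
   If x ∈ Ker(μ) and T⁻¹(x) = Σ a_i ⊗ b_i, summing yields
   Σ a_i → δ(b_i) = μ(x) ⊗ 1 - x = -x, so Ker(μ) is generated by the image of δ
   already as a left module. *)
Require Import Defs.
From HB Require Import structures.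
From mathcomp Require Import all_boot all_algebra.

Set Implicit Arguments.
Unset Strict Implicit.
Unset Printing Implicit Defensive.

Import GRing.Theory.
Local Open Scope ring_scope.

Section Generation.
Variables (k : fieldType) (D : algebra k).
Variables (T : {linear D ⊗ D -> D ⊗ D}) (hT : twistor D T).

Lemma lin_sub (U V : lmodType k) (f : U -> V) x y :
  lin f -> f (x - y) = f x - f y.
Proof. by move=> lf; rewrite addrC -scaleN1r lf scaleN1r addrC. Qed.

(** Since [T] fixes every [d ⊗ₜ 1], one of the two twists is trivial on each term: [T_13] on the
    term from [b ⊗ₜ 1], and [T_12] on the term from [1 ⊗ₜ b]. A single [T (a ⊗ₜ b)] remains. *)
Lemma twisted_lact_deltaE (a b : D) :
  twisted_lact T a (b ⊗ₜ alg_one D - alg_one D ⊗ₜ b) =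
    mu D (T (a ⊗ₜ b)) ⊗ₜ alg_one D - T (a ⊗ₜ b).
Proof.
rewrite lin_sub; last exact: (twisted_lact_lin T).2.
rewrite !twisted_lactE; congr (_ - _).
  rewrite (twisted_mulE T) pure_Jl; apply: eq_J => x y.
  rewrite (J_1r hT) //; split=> ?; last exact: lin_purer.
  by apply/lin_purel/lin_app/lin_purel.
rewrite (J_1r hT).
  by rewrite TJ; apply: eq_J => x y; rewrite alg_mul1r.
by split=> ?; [apply: lin_J1|apply: lin_JF => *; apply/lin_purel/lin_app/lin_purer] => //;
  split=> ?; [apply/lin_purel/lin_app/lin_purel|apply: lin_purer].
Qed.

(** Mirror image of the left formula, with [T] fixing [1 ⊗ₜ d] in place of [d ⊗ₜ 1]. *)
Lemma twisted_ract_deltaE (a b : D) :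
  twisted_ract T (a ⊗ₜ alg_one D - alg_one D ⊗ₜ a) b =
    T (a ⊗ₜ b) - alg_one D ⊗ₜ mu D (T (a ⊗ₜ b)).
Proof.
rewrite (lin_sub (f := (twisted_ract T)^~ b)); last exact: (twisted_ract_lin T).1.
rewrite !twisted_ractE; congr (_ - _).
  rewrite (J_1l hT).
    by rewrite TJ; apply: eq_J => x y; rewrite alg_mul1l.
  by split=> ?; [apply: lin_JF => *; apply/lin_purer/lin_app/lin_purel|apply: lin_J2] => //;
    split=> ?; [apply: lin_purel|apply/lin_purer/lin_app/lin_purer].
rewrite (twisted_mulE T) pure_Jr; apply: eq_J => x y.
rewrite (J_1l hT) //; split=> ?; first exact: lin_purel.
by apply/lin_purer/lin_app/lin_purer.
Qed.

(** For the Leibniz rule, add the two action formulas: the terms [T (a ⊗ₜ b)] cancel, leaving δ of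
    the twisted product. *)
Lemma kermu_delta_derivation : derivation (kermu_bimodule hT) (kermu_delta D).
Proof.
split=> [a x y|a b]; apply: val_inj.
  rewrite linearP /= linearPl linearPr.
  by rewrite scalerBr opprD addrACA.
rewrite linearD; apply: esym.
apply: etrans (congr2 +%R (twisted_lact_deltaE a b) (twisted_ract_deltaE a b)) _.
by rewrite addrA subrK.
Qed.

(** The right-hand side is linear in [y], and on pure tensors it is a → δ(b), so induction on sums
    of pure tensors covers all of D ⊗ D. The element [m] packages the value with its membership in
    Ker(μ), where [N] lives. *)
Lemma subbimodule_lact_delta (N : kermu_bimodule hT -> Prop) :
  subbimodule N -> (forall b, N (kermu_delta D b)) ->
  forall y, exists2 m : kermu D,
    N m & kermu_val m = mu D (T y) ⊗ₜ alg_one D - T y.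
Proof.
move=> [N0 ND _ NL _] Ndelta.
elim/tensor_ind=> [|a b y [m Nm mE]].
  by exists 0 => //; rewrite !linear0 linear0l addr0.
exists (kermu_lact hT a (kermu_delta D b) + m).
  by apply: ND => //; exact: NL.
rewrite [LHS](linearD (val : kermu D -> _)) /= mE.
apply: etrans (congr1 (+%R^~ _) (twisted_lact_deltaE a b)) _.
by rewrite !linearD linearDl /= addrACA.
Qed.

End Generation.

Theorem proposition5p7 (k : fieldType) (D : algebra k)
    (T : {linear D ⊗ D -> D ⊗ D}) (hT : twistor D T) :
  bijective T ->
  first_order_differential_calculus (kermu_bimodule hT) (kermu_delta D).
Proof.
move=> [T' _ T'K]; split; first exact: kermu_delta_derivation.
move=> N Nsub Ndelta x.
have Nd b : N (kermu_delta D b) by apply: Ndelta; exists b.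
(* The preimage of [x] under [T] makes the subtracted term [x] itself. *)
have [m Nm mE] := subbimodule_lact_delta Nsub Nd (T' (kermu_val x)).
(* As μ(x) = 0, the formula for [m] reduces to -x, hence the scalar -1. *)
suff -> : x = -1 *: m by exact: (subbimodZ Nsub (-1) Nm).
apply: val_inj; rewrite [RHS](linearZ_LR (val : kermu D -> _)).
rewrite /= mE T'K; have /eqP -> := kermuP x.
by rewrite linear0l sub0r scaleN1r opprK.
Qed.
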